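(* For $m,k\in\mathbb{N}$ and $-1<\alpha<0$, the Type III exceptional $X_m$-Laguerre polynomial $L_{m,m+k}^{\mathrm{III},\alpha}(x)$ can be written as $$L_{m,m+k}^{\mathrm{III},\alpha}(x)=(k+\alpha)L_{k-2}^{\alpha+1}(x)L_m^{-\alpha-1}(-x)+(m+1)L_{k-1}^{\alpha+1}(x)L_{m+1}^{-\alpha-1}(-x)-(m+k)L_{k-1}^{\alpha+1}(x)L_m^{-\alpha-1}(-x).$$
   Context: $\mathbb{N}=\{1,2,\dots\}$. For $a\in\mathbb{R}$ and integer $n\ge0$ the classical Laguerre polynomial is $L_n^a(x)=\sum_{j=0}^n\binom{n+a}{n-j}\frac{(-x)^j}{j!}$, with $\binom{r}{i}=r(r-1)\cdots(r-i+1)/i!$; $L_n^a:=0$ for $n<0$. The Type III exceptional $X_m$-Laguerre polynomials are $L_{m,0}^{\mathrm{III},\alpha}(x)=1$ and, for $n\ge m+1$, $$L_{m,n}^{\mathrm{III},\alpha}(x)=xL_{n-m-2}^{\alpha+2}(x)L_m^{-\alpha-1}(-x)+(m+1)L_{n-m-1}^{\alpha+1}(x)L_{m+1}^{-\alpha-2}(-x).$$ *)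

(* Defs.v *)
From mathcomp Require Import all_boot all_order all_algebra.
From mathcomp Require Import reals.

Set Implicit Arguments.
Unset Strict Implicit.
Unset Printing Implicit Defensive.

Import Order.TTheory GRing.Theory Num.Theory.

Local Open Scope ring_scope.

Definition gbinom (R : realType) (r : R) (i : nat) : R :=
  (\prod_(l < i) (r - l%:R)) / (i`!)%:R.

Definition laguerre (R : realType) (n : int) (a : R) : {poly R} :=
  match n with
  | Posz n' =>
      \sum_(j < n'.+1)
        (gbinom (n'%:R + a) (n' - j)%N / (j`!)%:R) *: (- 'X) ^+ j
  | Negz _ => 0
  end.

(* [n - m - 2] and [n - m - 1] are integer subtractions.  The degrees
   [0 < n <= m] do not occur in the family; there the formula gives 0, because
   both Laguerre indices are negative. *)
Definition xlaguerreIII (R : realType) (m n : nat) (alpha : R) : {poly R} :=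
  if n == 0%N then 1
  else
    'X * laguerre (n%:Z - m%:Z - 2) (alpha + 2)
       * (laguerre m (- alpha - 1) \Po (- 'X))
    + (m.+1)%:R *: (laguerre (n%:Z - m%:Z - 1) (alpha + 1)
       * (laguerre m.+1 (- alpha - 2) \Po (- 'X))).

(* Main.v *)
Require Import Defs.
From mathcomp Require Import all_boot all_order all_algebra.
From mathcomp Require Import reals ring.
Import Order.TTheory GRing.Theory Num.Theory.
Local Open Scope ring_scope.

(** Write [A] for [L_m^(-alpha-1)(-x)].  The family is rewritten with two
    classical contiguity relations between Laguerre polynomials:
    - [L_(n+1)^(a-1) = L_(n+1)^a - L_n^a] turns [L_(m+1)^(-alpha-2)(-x)] into
      [L_(m+1)^(-alpha-1)(-x) - A];
    - [x L_(n-1)^(a+1) = (n+a) L_(n-1)^a - n L_n^a], for [n = k-1] and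
      [a = alpha+1], turns [x L_(k-2)^(alpha+2)] into
      [(k+alpha) L_(k-2)^(alpha+1) - (k-1) L_(k-1)^(alpha+1)].
    The two multiples of [L_(k-1)^(alpha+1) A] thus produced add up to
    [-(m+1) - (k-1) = -(m+k)].  Coefficient by coefficient, the first relation
    is Pascal's rule for generalized binomials and the second is the absorption
    identity [(i+1) binom(r+1, i+1) = (r+1) binom(r, i)]. *)

Lemma fact_natr_neq0 (R : realType) (i : nat) : (i`!)%:R != 0 :> R.
Proof. by rewrite pnatr_eq0 -lt0n fact_gt0. Qed.

Lemma gbinom0 (R : realType) (r : R) : gbinom r 0 = 1.
Proof. by rewrite /gbinom big_ord0 fact0 divr1. Qed.

(** Splitting off the last factor [r - i] of the falling factorial. *)
Lemma gbinom_recr (R : realType) (r : R) (i : nat) :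
  i.+1%:R * gbinom r i.+1 = (r - i%:R) * gbinom r i.
Proof.
rewrite /gbinom big_ord_recr /= factS natrM.
have fi := fact_natr_neq0 R i.
have i1 : i.+1%:R != 0 :> R by rewrite pnatr_eq0.
by field; rewrite nat1r fi i1.
Qed.

(** Splitting off the first factor [r + 1] of the falling factorial. *)
Lemma gbinom_absorb (R : realType) (r : R) (i : nat) :
  i.+1%:R * gbinom (r + 1) i.+1 = (r + 1) * gbinom r i.
Proof.
rewrite /gbinom big_ord_recl /= subr0 factS natrM.
under eq_bigr => l _.
  have -> : r + 1 - (bump 0 l)%:R = r - l%:R by rewrite /bump -nat1r; ring.
  over.
have fi := fact_natr_neq0 R i.
have i1 : i.+1%:R != 0 :> R by rewrite pnatr_eq0.
by field; rewrite nat1r fi i1.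
Qed.

(** After multiplication by [i + 1], all three terms are multiples of
    [binom(r, i)], by the two recurrences above. *)
Lemma gbinom_pascal (R : realType) (r : R) (i : nat) :
  gbinom (r + 1) i.+1 = gbinom r i.+1 + gbinom r i.
Proof.
have i1 : i.+1%:R != 0 :> R by rewrite pnatr_eq0.
apply: (mulfI i1).
by rewrite mulrDr gbinom_absorb gbinom_recr -natr1; ring.
Qed.

Lemma coef_laguerre (R : realType) (n : nat) (a : R) (j : nat) :
  (laguerre n a)`_j =
    if (j <= n)%N then (-1) ^+ j * gbinom (n%:R + a) (n - j) / (j`!)%:R else 0.
Proof.
have -> : laguerre n a =
    \poly_(i < n.+1) ((-1) ^+ i * gbinom (n%:R + a) (n - i) / (i`!)%:R).
  rewrite poly_def; apply: eq_bigr => i _.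
  rewrite -scaleN1r exprZn scalerA.
  by congr (_ *: _); ring.
by rewrite coef_poly ltnS.
Qed.

Lemma laguerre_lower_param (R : realType) (n : nat) (a : R) :
  laguerre n.+1 (a - 1) = laguerre n.+1 a - laguerre n a.
Proof.
apply/polyP => j; rewrite coefB !coef_laguerre.
have -> : n.+1%:R + (a - 1) = n%:R + a by rewrite -natr1; ring.
have -> : n.+1%:R + a = n%:R + a + 1 by rewrite -natr1; ring.
case: (ltngtP j n.+1) => [|lt_nj|->].
- by rewrite ltnS => le_jn; rewrite le_jn subSn // gbinom_pascal; ring.
- by rewrite leqNgt (ltnW lt_nj) subr0.
- by rewrite ltnn subnn !gbinom0 subr0.
Qed.

(** At [x^j], with [j <= n], the relation is the absorption identity for
    [binom(n+a+1, n+1-j)], since [n + 1 = j + (n + 1 - j)]; the factor [j] comes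
    from [1/(j-1)! = j/j!]. *)
Lemma laguerre_mulX (R : realType) (n : nat) (a : R) :
  'X * laguerre n (a + 1) =
    (n.+1%:R + a) *: laguerre n a - n.+1%:R *: laguerre n.+1 a.
Proof.
apply/polyP => j; rewrite coefB !coefZ coefXM !coef_laguerre.
have -> : n%:R + (a + 1) = n%:R + a + 1 by ring.
have -> : n.+1%:R + a = n%:R + a + 1 by rewrite -natr1; ring.
case: j => [|j] /=.
  rewrite !subn0 fact0 expr0 !mul1r !divr1 gbinom_absorb.
  by rewrite subrr.
have fj := fact_natr_neq0 R j.
have j1 : j.+1%:R != 0 :> R by rewrite pnatr_eq0.
rewrite exprS subSS ltnS factS natrM.
case: (ltngtP j n) => [lt_jn|lt_nj|->].
- have absorb := gbinom_absorb R (n%:R + a) (n - j.+1).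
  rewrite -subSn // subSS in absorb.
  have -> : n.+1%:R = j.+1%:R + (n - j)%:R :> R.
    by rewrite -natrD addSn subnKC // ltnW.
  rewrite [X in _ = X - _](_ : _ =
    -1 * (-1) ^+ j * ((n%:R + a + 1) * gbinom (n%:R + a) (n - j.+1))
      / (j.+1%:R * (j`!)%:R)); last by ring.
  rewrite -absorb.
  by field; rewrite nat1r fj j1.
- by rewrite !mulr0 subrr.
- rewrite subnn !gbinom0 mulr0 sub0r.
  have fn := fact_natr_neq0 R n.
  have n1 : n.+1%:R != 0 :> R by rewrite pnatr_eq0.
  by field; rewrite nat1r fn n1.
Qed.

Theorem lemma5p4 (R : realType) (m k : nat) (alpha : R)
  (hm : (0 < m)%N) (hk : (0 < k)%N) (halpha : -1 < alpha < 0) :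
  xlaguerreIII m (m + k)%N alpha =
    (k%:R + alpha) *: (laguerre (k%:Z - 2) (alpha + 1)
                        * (laguerre m (- alpha - 1) \Po (- 'X)))
    + (m.+1)%:R *: (laguerre (k%:Z - 1) (alpha + 1)
                        * (laguerre m.+1 (- alpha - 1) \Po (- 'X)))
    - (m + k)%:R *: (laguerre (k%:Z - 1) (alpha + 1)
                        * (laguerre m (- alpha - 1) \Po (- 'X))).
Proof.
case: k hk => // k _; rewrite /xlaguerreIII addnS; case: eqP => // _.
have -> : (m + k).+1%:Z - m%:Z - 2 = k.+1%:Z - 2 by rewrite -addnS PoszD; ring.
have -> : (m + k).+1%:Z - m%:Z - 1 = k%:Z by rewrite -addnS PoszD intS; ring.
have -> : k.+1%:Z - 1 = k%:Z by rewrite intS; ring.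
have -> : - alpha - 2 = - alpha - 1 - 1 by ring.
rewrite laguerre_lower_param comp_polyB.
have -> : 'X * laguerre (k.+1%:Z - 2) (alpha + 2) =
    (k.+1%:R + alpha) *: laguerre (k.+1%:Z - 2) (alpha + 1)
    - k%:R *: laguerre k (alpha + 1).
  (* For [k = 0] the index is [-1], where the polynomial is [0] by convention. *)
  case: k => [|k]; first by rewrite mulr0 scaler0 scale0r subr0.
  have -> : k.+2%:Z - 2 = k%:Z by rewrite !intS; ring.
  have -> : alpha + 2 = alpha + 1 + 1 by ring.
  by rewrite laguerre_mulX; congr (_ *: _ - _); rewrite -!natr1; ring.
rewrite -!mul_polyC -addSn natrD -!natr1 !polyCD.
ring.
Qed.
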